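(* Let $p$ be an odd prime and let $G$ be a finite powerful $p$-group. If $[G,G]$ is cyclic, then $G$ is powerfully solvable of powerful derived length at most $2$.
   Context: $G^{p}$ denotes the subgroup generated by all $p$-th powers of elements of $G$. A finite $p$-group $G$ is powerful if $[G,G]\le G^p$. For subgroups $K\le H\le G$, a chain $H=H_0\ge H_1\ge\cdots\ge H_n=K$ is powerfully abelian if $[H_i,H_i]\le H_{i+1}^p$ for $i=0,\ldots,n-1$. A finite $p$-group $G$ is powerfully solvable if there is a powerfully abelian chain $G=G_0\ge G_1\ge\cdots\ge G_n=1$; the smallest possible length $n$ of such a chain is the powerful derived length of $G$. *)

(* Defs.v *)
From HB Require Import structures.
From mathcomp Require Import all_boot all_fingroup all_solvable.

Set Implicit Arguments.
Unset Strict Implicit.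
Unset Printing Implicit Defensive.

Local Open Scope group_scope.

Section PowerfulGroups.

Variables (gT : finGroupType) (p : nat).
Implicit Types G H K : {group gT}.

(* Unlike 'Mho^1(G), this is the subgroup generated by p-th powers for the
   given p, with no reference to the orders of the elements. *)
Definition power_subgroup (A : {set gT}) : {set gT} :=
  <<[set x ^+ p | x in A]>>.

Definition powerful G : bool :=
  p.-group G && ([~: G, G] \subset power_subgroup G).

Definition powerfully_abelian_step H K : bool :=
  (K \subset H) && ([~: H, H] \subset power_subgroup K).

(* H is H_0 and s = [:: H_1; ...; H_n], so the length n of the chain is
   size s, and its end K is last H s. *)
Definition powerfully_abelian_chain H K (s : seq {group gT}) : bool :=
  path powerfully_abelian_step H s && (last H s == K).

(* Boolean because {group gT} is finite; this lets ex_minn pick the minimal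
   length below. *)
Definition has_powerfully_abelian_chain G (n : nat) : bool :=
  [exists s : n.-tuple {group gT}, powerfully_abelian_chain G 1%G s].

Definition powerfully_solvable G : Prop :=
  p.-group G /\ exists n, has_powerfully_abelian_chain G n.

Definition powerful_derived_length G (solG : powerfully_solvable G) : nat :=
  ex_minn (proj2 solG).

End PowerfulGroups.

(* Main.v *)
(** Write [G, G] = <c> and let K = <c^p>. Modulo K the derived subgroup of G is
    central of exponent p, so, p being odd, x |-> x^p is a morphism modulo K.
    Since G is powerful, c is therefore congruent modulo K to a single power
    x^p, and then x^p generates <c>, as K is the Frattini subgroup of <c>. Thus
    G >= <x> >= 1 is a powerfully abelian chain. *)
Require Import Defs.
From HB Require Import structures.
From mathcomp Require Import all_boot all_fingroup all_solvable.

Local Open Scope group_scope.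

(** In class 2, (xy)^p = x^p y^p [y,x]^(p(p-1)/2). As p is odd, p divides p(p-1)/2, so the
    commutator factor vanishes and the p-th powers are already closed under products. *)
Lemma power_subgroup_class2 (gT : finGroupType) (p : nat) (P : {group gT}) :
    odd p -> [~: P, P] \subset 'Z(P) -> exponent [~: P, P] %| p ->
  power_subgroup p P = [set x ^+ p | x in P].
Proof.
move=> oddp sP'Z expP'; apply: gen_set_id; apply/group_setP; split.
  by apply/imsetP; exists 1; rewrite ?group1 ?expg1n.
move=> _ _ /imsetP[x Px ->] /imsetP[y Py ->].
have R'P: [~ y, x] \in [~: P, P] by rewrite mem_commg.
have /centerP[_ cR] := subsetP sP'Z _ R'P.
apply/imsetP; exists (x * y); first exact: groupM.
rewrite expMg_Rmul; [|exact/commute_sym/cR|exact/commute_sym/cR].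
by rewrite bin2odd // expgM (exponentP expP' _ R'P) expg1n mulg1.
Qed.

(** If p does not divide i, then i is coprime to the order of c, so c^i generates <[c]> and cannot
    lie in a proper subgroup. *)
Lemma proper_cycle_sub_expg (gT : finGroupType) (p : nat) (c : gT)
    (H : {group gT}) :
  prime p -> p.-elt c -> H \proper <[c]> -> H \subset <[c ^+ p]>.
Proof.
move=> p_pr p_c /andP[sHc ncH]; apply/subsetP=> y Hy.
have /cycleP[i def_y] := subsetP sHc y Hy.
have [/dvdnP[k def_i] | p'i] := boolP (p %| i).
  by rewrite def_y def_i mulnC expgM mem_cycle.
case/negP: ncH; suff /eqP-> : generator <[c]> y by rewrite cycle_subG.
rewrite def_y generator_coprime; apply: (@pnat_coprime p) => //.
by rewrite p'natE.
Qed.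

Lemma powerful_cyclic_der_eq_cycle_expg (gT : finGroupType) (p : nat)
    (G : {group gT}) :
    prime p -> odd p -> powerful p G -> cyclic [~: G, G] ->
  exists2 x, x \in G & [~: G, G] = <[x ^+ p]>.
Proof.
move=> p_pr oddp /andP[pG sG'Gp] cycG'; have /cyclicP[c defG'] := cycG'.
have sG'G: [~: G, G] \subset G by rewrite der1_subG.
have G'c: c \in [~: G, G] by rewrite defG' cycle_id.
have p_c: p.-elt c by apply: mem_p_elt pG _; apply: (subsetP sG'G).
(* The strict inclusion of [[G, G], G] in [G, G] used below requires c to be nontrivial. *)
have [c1 | ntc] := eqVneq c 1.
  by exists 1; rewrite ?group1 // expg1n defG' c1.
set K := <[c ^+ p]>%G.
have sKG': K \subset [~: G, G] by rewrite cycle_subG groupX.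
have nsKG: K <| G.
  apply: char_normal_trans (der_normal 1 G).
  by rewrite sub_cyclic_char.
have nKG := normal_norm nsKG.
have nKc: c \in 'N(K) by apply: (subsetP nKG); apply: (subsetP sG'G).
(* Nilpotency of G makes [[G, G], G] a proper subgroup of <[c]>, hence contained in K; this yields
   centrality of the derived subgroup of G / K. *)
have sG'G_K: [~: [~: G, G], G] \subset K.
  apply: proper_cycle_sub_expg => //; rewrite -defG'.
  apply: nil_comm_properl (pgroup_nil pG) sG'G _ _.
    by rewrite /= defG' cycle_eq1.
  by rewrite subsetI subxx commg_norml.
have defGb': [~: G / K, G / K] = <[coset K c]>.
  by rewrite -quotientR // defG' quotient_cycle.
have sGb'Z: [~: G / K, G / K] \subset 'Z(G / K).
  by rewrite subsetI der1_subG -quotientR //= quotient_cents2r.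
have expGb': exponent [~: G / K, G / K] %| p.
  rewrite defGb' exponent_cycle order_dvdn -morphX //=.
  by rewrite coset_id ?cycle_id.
have: coset K c \in power_subgroup p (G / K).
  (* The preimage of (G / K)^p is a group, so it contains G^p once it contains each generator
     x^p. *)
  suff: c \in coset K @*^-1 (<<[set x ^+ p | x in G / K]>>%G).
    by move/morphpreP=> [].
  apply: subsetP G'c; apply: subset_trans sG'Gp _; rewrite gen_subG.
  apply/subsetP=> _ /imsetP[x Gx ->]; have nKx := subsetP nKG x Gx.
  rewrite mem_morphpre ?groupX //= morphX //; apply/mem_gen/imset_f.
  exact: mem_quotient.
rewrite power_subgroup_class2 // => /imsetP[_ /morphimP[x nKx Gx ->] eq_c_xp].
exists x => //; have /rcosetP[_ /cycleP[k ->] def_xp]: x ^+ p \in K :* c.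
  by rewrite -val_coset //= eq_c_xp -morphX // val_coset ?rcoset_refl ?groupX.
(* Here x^p = c^(pk+1), and pk+1 is coprime to p, hence to the order of c. *)
rewrite defG'; apply/eqP; rewrite -/(generator <[c]> _) def_xp.
rewrite -expgM -expgSr generator_coprime; apply: (@pnat_coprime p) => //.
by rewrite p'natE // -addn1 dvdn_addr ?dvdn_mulr // Euclid_dvd1.
Qed.

Theorem proposition2p1 (gT : finGroupType) (p : nat) (G : {group gT}) :
  prime p -> odd p -> powerful p G -> cyclic [~: G, G] ->
  exists solG : powerfully_solvable p G, (powerful_derived_length solG <= 2)%N.
Proof.
move=> p_pr oddp powG cycG'.
have [x Gx defG'] :=
  powerful_cyclic_der_eq_cycle_expg _ _ _ p_pr oddp powG cycG'.
have chain2: has_powerfully_abelian_chain p G 2.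
  (* H_0 = G stays outside the tuple. The first step holds because x^p is a p-th power from <[x]>,
     the second because <[x]> is abelian. *)
  apply/existsP; exists [tuple <[x]>%G; 1%G].
  rewrite /powerfully_abelian_chain /= eqxx !andbT /powerfully_abelian_step.
  rewrite cycle_subG Gx defG' cycle_subG (commG1P (cycle_abelian x)) !sub1G.
  by rewrite !andbT; apply/mem_gen/imset_f/cycle_id.
have solG: powerfully_solvable p G.
  by case/andP: powG => pG _; split=> //; exists 2.
exists solG; rewrite /powerful_derived_length.
by case: ex_minnP => n _ /(_ 2 chain2).
Qed.
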